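(* Let $n\geq 2$, let $X\in\mathsf{Cat}^n_{\mathsf{hd}}$, and for each $s\geq 2$ consider the induced Segal map in $\mathsf{Cat}^{n-1}_{\mathsf{hd}}$ $$\hat\mu_s: X_1\times_{X_0}\overset{s}{\cdots}\times_{X_0}X_1\longrightarrow X_1\times_{X_0^d}\overset{s}{\cdots}\times_{X_0^d}X_1$$ induced by the discretization map $\gamma_{(n-1)}:X_0\to X_0^d$. Then $\hat\mu_s$ is an $(n-1)$-equivalence.
   Context: **$n$-fold categories.** $\mathsf{Cat}^0=\mathsf{Set}$, $\mathsf{Cat}^1=\mathsf{Cat}$ (small categories and functors), and $\mathsf{Cat}^n=\mathsf{Cat}(\mathsf{Cat}^{n-1})$ is the category of internal categories and internal functors in $\mathsf{Cat}^{n-1}$. Iterating the nerve gives the fully faithful multinerve $N_{(n)}:\mathsf{Cat}^n\to[(\Delta^{op})^n,\mathsf{Set}]$, and via it we identify $\mathsf{Cat}^n$ with the full subcategory of $n$-simplicial sets $X$ whose Segal maps in each of the $n$ simplicial directions are isomorphisms. For $X\in\mathsf{Cat}^n$ and $s\ge 0$, $X_s\in\mathsf{Cat}^{n-1}$ denotes $X(s,-,\dots,-)$; thus $\mathsf{Cat}^n$ is the category of simplicial objects in $\mathsf{Cat}^{n-1}$ whose Segal maps are isomorphisms. $X_{s_1\dots s_{n-1}}\in\mathsf{Cat}$ denotes the category whose nerve is $X(s_1,\dots,s_{n-1},-)$. An $n$-fold category is discrete if its multinerve is a constant functor. **Homotopically discrete $n$-fold categories.** Let $p:\mathsf{Cat}\to\mathsf{Set}$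 send a category to its set of isomorphism classes of objects. Set $\mathsf{Cat}^0_{\mathsf{hd}}=\mathsf{Set}$, let $\mathsf{Cat}^1_{\mathsf{hd}}=\mathsf{Cat}_{\mathsf{hd}}$ be the full subcategory of $\mathsf{Cat}$ of equivalence relations (groupoids equivalent to discrete categories), and let $p^{(1)}$ be the restriction of $p$. Inductively, for $n\ge2$, $\mathsf{Cat}^n_{\mathsf{hd}}$ is the full subcategory of $[\Delta^{op},\mathsf{Cat}^{n-1}_{\mathsf{hd}}]$ on those $X$ such that (i) the Segal maps $X_s\to X_1\times_{X_0}\overset{s}{\cdots}\times_{X_0}X_1$ are isomorphisms for all $s\ge 2$ (so $X\in\mathsf{Cat}^n$); (ii) the simplicial object $s\mapsto p^{(n-1)}(X_s)$ in $\mathsf{Cat}^{n-2}_{\mathsf{hd}}$ is (the nerve in the first direction of) an object of $\mathsf{Cat}^{n-1}_{\mathsf{hd}}$; this object is denoted $p^{(n)}X$, giving a functor $p^{(n)}:\mathsf{Cat}^n_{\mathsf{hd}}\to\mathsf{Cat}^{n-1}_{\mathsf{hd}}$. Equivalently, $(p^{(n)}X)_{s_1\dots s_{n-1}}=p(X_{s_1\dots s_{n-1}})$. **Discretization.** Let $d:\mathsf{Set}\to\mathsf{Cat}$ be the discrete category functor, and let $d^{(n)}:\mathsf{Cat}^{n-1}\to\mathsf{Cat}^n$ be the discrete inclusion in the $n$-th direction: $(d^{(n)}Y)_{s_1\dots s_{n-1}}=d(Y_{s_1\dots s_{n-1}})$, with $d^{(1)}=d$. For $X\in\mathsf{Cat}^n_{\mathsf{hd}}$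 let $\gamma^{(n)}_X:X\to d^{(n)}p^{(n)}X$ be given levelwise by the canonical functors $X_{s_1\dots s_{n-1}}\to d\,p\,X_{s_1\dots s_{n-1}}$ (sending each object to its isomorphism class). Put $X^d=d^{(n)}\cdots d^{(1)}p^{(1)}\cdots p^{(n)}X$ (a discrete $n$-fold category, functorial in $X$) and let $\gamma_{(n)}:X\to X^d$ be the composite $X\xrightarrow{\gamma^{(n)}}d^{(n)}p^{(n)}X\xrightarrow{d^{(n)}\gamma^{(n-1)}}d^{(n)}d^{(n-1)}p^{(n-1)}p^{(n)}X\to\cdots\to X^d$. For $X\in\mathsf{Cat}^n_{\mathsf{hd}}$ with $n\ge2$, $X_0\in\mathsf{Cat}^{n-1}_{\mathsf{hd}}$ and $X_0^d=(X_0)^d$, with discretization map $\gamma_{(n-1)}:X_0\to X_0^d$. **$n$-equivalences.** A $1$-equivalence in $\mathsf{Cat}^1_{\mathsf{hd}}$ is an equivalence of categories. For $n\ge2$, $X\in\mathsf{Cat}^n_{\mathsf{hd}}$ and $a,b\in X_0^d$ (elements of the underlying set), $X(a,b)$ is the fiber at $(a,b)$ of the composite $X_1\xrightarrow{(d_0,d_1)}X_0\times X_0\xrightarrow{\gamma\times\gamma}X_0^d\times X_0^d$, where $\gamma:X_0\to X_0^d$ is the discretization map. A map $f:X\to Y$ in $\mathsf{Cat}^n_{\mathsf{hd}}$ is an $n$-equivalence if for all $a,b\in X_0^d$ the induced map $f(a,b):X(a,b)\to Y(fa,fb)$ is an $(n-1)$-equivalence and $p^{(n)}f$ is an $(n-1)$-equivalence.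 **Induced Segal maps.** For $1\le j\le s$ let $\nu_j:X_s\to X_1$ be induced by $[1]\to[s]$, $0\mapsto j-1$, $1\mapsto j$. Let $X_1\times_{X_0^d}\overset{s}{\cdots}\times_{X_0^d}X_1$ be the limit of $s$ copies of $X_1$ in which consecutive copies are glued by requiring $\gamma_{(n-1)}d_0$ on the $j$-th copy to equal $\gamma_{(n-1)}d_1$ on the $(j+1)$-st copy. The induced Segal map $\hat\mu_s:X_s\cong X_1\times_{X_0}\overset{s}{\cdots}\times_{X_0}X_1\to X_1\times_{X_0^d}\overset{s}{\cdots}\times_{X_0^d}X_1$ is the unique map with $\mathrm{pr}_j\hat\mu_s=\nu_j$ for all $j$, where $\mathrm{pr}_j$ is the $j$-th projection. *)

(* Defs.v *)
From mathcomp Require Import all_boot.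
From mathcomp Require Import boolp.
From Stdlib Require Import Relation_Operators.

Set Implicit Arguments.
Unset Strict Implicit.
Unset Printing Implicit Defensive.

#[local] Obligation Tactic := intros; simpl; try done.

Record cat := Cat {
  ob :> Type;
  hom : ob -> ob -> Type;
  idm : forall a, hom a a;
  cmp : forall a b c, hom b c -> hom a b -> hom a c;
  cmp1m : forall a b (f : hom a b), cmp (idm b) f = f;
  cmpm1 : forall a b (f : hom a b), cmp f (idm a) = f;
  cmpA : forall a b c d (h : hom c d) (g : hom b c) (f : hom a b),
    cmp h (cmp g f) = cmp (cmp h g) f }.
Arguments idm {c0} a.

Record psh (C : cat) := Psh {
  pob :> C -> Type;
  pmap : forall s t : C, hom s t -> pob t -> pob s;
  pmap1 : forall s (x : pob s), pmap (idm s) x = x;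
  pmapM : forall s t r (g : hom t r) (f : hom s t) (x : pob r),
    pmap (cmp g f) x = pmap f (pmap g x) }.
Arguments pmap {C} p {s t}.

Lemma psh_eq (C : cat) (P : C -> Type)
    (f g : forall s t : C, hom s t -> P t -> P s) f1 fM g1 gM :
  (forall s t u x, f s t u x = g s t u x) ->
  @Psh C P f f1 fM = @Psh C P g g1 gM.
Proof.
move=> fg; have efg : f = g.
  apply: functional_extensionality_dep => s.
  apply: functional_extensionality_dep => t.
  by apply: funext => u; apply: funext => x.
case: _ / efg g1 gM {fg} => g1 gM.
by rewrite (Prop_irrelevance f1 g1) (Prop_irrelevance fM gM).
Qed.

Record nattr (C : cat) (X Y : psh C) := NatTr {
  ntf :> forall s : C, X s -> Y s;
  ntP : forall s t (u : hom s t) (x : X t),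
    ntf (pmap X u x) = pmap Y u (ntf x) }.

Program Definition ntid (C : cat) (X : psh C) : nattr X X :=
  {| ntf := fun s x => x |}.

Program Definition ntcomp (C : cat) (X Y Z : psh C)
  (g : nattr Y Z) (f : nattr X Y) : nattr X Z :=
  {| ntf := fun s x => g s (f s x) |}.
Next Obligation. by rewrite !ntP. Qed.

Definition is_iso (C : cat) (X Y : psh C) (f : nattr X Y) : Prop :=
  exists g : nattr Y X,
    (forall s x, g s (f s x) = x) /\ (forall s y, f s (g s y) = y).

Lemma sig_inj (A : Type) (P : A -> Prop) (x y : {a : A | P a}) :
  sval x = sval y -> x = y.
Proof.
case: x y => [x hx] [y hy] /= exy; case: _ / exy hy => hy.
by rewrite (Prop_irrelevance hx hy).
Qed.

Definition mono (m n : nat) (f : 'I_m.+1 -> 'I_n.+1) : Prop :=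
  forall i j : 'I_m.+1, i <= j -> f i <= f j.

(* The object m of [simplex] is the ordinal [m] = {0 < ... < m}. *)
Program Definition simplex : cat := {|
  ob := nat;
  hom := fun m n => {f : 'I_m.+1 -> 'I_n.+1 | mono f};
  idm := fun m => exist _ id _;
  cmp := fun m n p g f => exist _ (fun i => sval g (sval f i)) _ |}.
Next Obligation. by move=> i j ij; apply: (svalP g); apply: (svalP f). Qed.
Next Obligation. exact: sig_inj. Qed.
Next Obligation. exact: sig_inj. Qed.
Next Obligation. exact: sig_inj. Qed.

Program Definition onec : cat := {|
  ob := unit; hom := fun _ _ => unit;
  idm := fun _ => tt; cmp := fun _ _ _ _ _ => tt |}.
Next Obligation. by case: f. Qed.
Next Obligation. by case: f. Qed.

Program Definition prodc (C D : cat) : cat := {|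
  ob := C * D;
  hom := fun a b => (hom a.1 b.1 * hom a.2 b.2)%type;
  idm := fun a => (idm a.1, idm a.2);
  cmp := fun _ _ _ g f => (cmp g.1 f.1, cmp g.2 f.2) |}.
Next Obligation. by rewrite !cmp1m; case: f. Qed.
Next Obligation. by rewrite !cmpm1; case: f. Qed.
Next Obligation. by rewrite !cmpA. Qed.

(* Delta^n.  The last direction is the outermost factor; the first direction
   is reached by [dcons]. *)
Fixpoint dpow (n : nat) : cat :=
  if n is m.+1 then prodc (dpow m) simplex else onec.

(* An n-fold category is represented by its multinerve, an n-simplicial set
   whose Segal maps are isomorphisms. *)
Notation msset n := (psh (dpow n)).

(* (k, (s_1, ..., s_n)) |-> (k, s_1, ..., s_n), functorially. *)
Fixpoint dcons (n : nat) (k : nat) : dpow n -> dpow n.+1 :=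
  match n return dpow n -> dpow n.+1 with
  | 0 => fun s => (s, k)
  | m.+1 => fun s => (dcons k s.1, s.2)
  end.

Fixpoint dconsm (n : nat) (k l : simplex) (phi : hom k l) :
    forall s t : dpow n, hom s t -> hom (dcons k s) (dcons l t) :=
  match n return forall s t : dpow n, hom s t -> hom (dcons k s) (dcons l t)
  with
  | 0 => fun s t u => (u, phi)
  | m.+1 => fun s t u => (dconsm phi u.1, u.2)
  end.

Lemma dconsm1 n (k : simplex) (s : dpow n) :
  dconsm (idm k) (idm s) = idm (dcons k s).
Proof. by elim: n s => [|n IH] s //=; rewrite IH. Qed.

Lemma dconsmM n (k l m : simplex) (psi : hom l m) (phi : hom k l)
    (s t r : dpow n) (v : hom t r) (u : hom s t) :
  dconsm (cmp psi phi) (cmp v u) = cmp (dconsm psi v) (dconsm phi u).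
Proof. by elim: n s t r v u => [|n IH] s t r v u //=; rewrite IH. Qed.

Lemma dcons_surj n (s : dpow n.+1) :
  exists (k : nat) (t : dpow n), s = dcons k t.
Proof.
elim: n s => [|n IH] [s k]; first by exists k, s.
by have [l [t ->]] := IH s; exists l, (t, k).
Qed.

Fixpoint dzero (n : nat) : dpow n :=
  match n return dpow n with 0 => tt | m.+1 => (dzero m, 0) end.

Program Definition to0 (k : nat) : @hom simplex k 0 :=
  exist _ (fun _ => ord0) _.

Lemma to0_uniq (k : nat) (f g : @hom simplex k 0) : f = g.
Proof. by apply: sig_inj; apply: funext => i; rewrite !ord1. Qed.

Fixpoint dto0 (n : nat) : forall s : dpow n, hom s (dzero n) :=
  match n return forall s : dpow n, hom s (dzero n) with
  | 0 => fun _ => tt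
  | m.+1 => fun s => (dto0 s.1, to0 s.2)
  end.

Lemma dto0_uniq n (s : dpow n) (f g : hom s (dzero n)) : f = g.
Proof.
elim: n s f g => [|n IH] s; first by case=> [] [].
move=> [f1 f2] [g1 g2]; rewrite (IH _ f1 g1).
by rewrite (to0_uniq f2 g2).
Qed.

Program Definition coface (m : nat) (i : 'I_m.+2) : @hom simplex m m.+1 :=
  exist _ (fun j => lift i j) _.
Next Obligation. by move=> j k jk; rewrite /= leq_bump2. Qed.

Program Definition vertex (m : nat) (i : 'I_m.+1) : @hom simplex 0 m :=
  exist _ (fun _ => i) _.

Program Definition edge (m : nat) (i j : 'I_m.+1) (ij : i <= j) :
    @hom simplex 1 m :=
  exist _ (fun k : 'I_2 => if k == ord0 then i else j) _.
Next Obligation.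
move=> k l; case: (eqVneq k ord0) => [->|k0]; first by case: eqVneq.
case: (eqVneq l ord0) => [->|//].
by rewrite leqn0 => /eqP k00; case/eqP: k0; apply: val_inj.
Qed.

(* 0 |-> j, 1 |-> j.+1; the copies of X_1 are indexed from 0 here. *)
Lemma spine_subproof (s : nat) (j : 'I_s) :
  widen_ord (leqnSn s) j <= lift ord0 j.
Proof. by rewrite lift0 /= leqnSn. Qed.

Definition spine (s : nat) (j : 'I_s) : @hom simplex 1 s :=
  edge (spine_subproof j).

Definition delta0 : @hom simplex 0 1 := coface ord0.
Definition delta1 : @hom simplex 0 1 := coface ord_max.

Lemma edge_delta0 m (i j : 'I_m.+1) (ij : i <= j) :
  @cmp simplex _ _ _ (edge ij) delta0 = vertex j.
Proof. by apply: sig_inj; apply: funext => k; rewrite ord1. Qed.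

Lemma edge_delta1 m (i j : 'I_m.+1) (ij : i <= j) :
  @cmp simplex _ _ _ (edge ij) delta1 = vertex i.
Proof. by apply: sig_inj; apply: funext => k; rewrite ord1. Qed.

(* The notions below read a simplicial set satisfying the Segal condition as
   the category of which it is the nerve: objects are the 0-simplices, arrows
   the 1-simplices, and 2-simplices witness composition. *)
Section Nerve.
Variable S : psh simplex.

Definition source (f : S 1) : S 0 := pmap S delta1 f.
Definition target (f : S 1) : S 0 := pmap S delta0 f.
Definition ident (x : S 0) : S 1 := pmap S (to0 1) x.

(* h is the composite of f followed by g *)
Definition composes (f g h : S 1) : Prop :=
  exists c : S 2, [/\ pmap S (coface (inord 2)) c = f,
                      pmap S (coface (inord 0)) c = g
                    & pmap S (coface (inord 1)) c = h].

Definition invertible (f : S 1) : Prop :=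
  exists g : S 1,
    composes f g (ident (source f)) /\ composes g f (ident (target f)).

Definition isomorphic (x y : S 0) : Prop :=
  exists f : S 1, [/\ source f = x, target f = y & invertible f].

Definition groupoid : Prop := forall f : S 1, invertible f.

End Nerve.

Definition naturally_isomorphic (S T : psh simplex) (F G : nattr S T) : Prop :=
  exists alpha : S 0 -> T 1,
    (forall x, [/\ source (alpha x) = F 0 x, target (alpha x) = G 0 x
                 & invertible (alpha x)]) /\
    (forall f : S 1, exists h : T 1,
       composes (F 1 f) (alpha (target f)) h /\
       composes (alpha (source f)) (G 1 f) h).

Definition equivalence (S T : psh simplex) (F : nattr S T) : Prop :=
  exists G : nattr T S,
    naturally_isomorphic (ntcomp G F) (ntid S) /\
    naturally_isomorphic (ntcomp F G) (ntid T).

(* The nerve of the discrete category on A. *)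
Program Definition constp (A : Type) : psh simplex :=
  {| pob := fun _ => A; pmap := fun _ _ _ x => x |}.

Section NerveMap.
Variables (S T : psh simplex) (F : nattr S T).

Lemma source_nt f : source (F 1 f) = F 0 (source f).
Proof. by rewrite /source ntP. Qed.

Lemma target_nt f : target (F 1 f) = F 0 (target f).
Proof. by rewrite /target ntP. Qed.

Lemma ident_nt x : ident (F 0 x) = F 1 (ident x).
Proof. by rewrite /ident ntP. Qed.

Lemma composes_nt f g h : composes f g h -> composes (F 1 f) (F 1 g) (F 1 h).
Proof. by case=> c [<- <- <-]; exists (F 2 c); split; rewrite ntP. Qed.

Lemma invertible_nt f : invertible f -> invertible (F 1 f).
Proof.
case=> g [fg gf]; exists (F 1 g); rewrite source_nt target_nt !ident_nt.
by split; apply: composes_nt.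
Qed.

Lemma isomorphic_nt x y : isomorphic x y -> isomorphic (F 0 x) (F 0 y).
Proof.
case=> f [<- <- fi]; exists (F 1 f); split; last exact: invertible_nt.
  exact: source_nt.
exact: target_nt.
Qed.

End NerveMap.

Section Quotient.
Variables (A : Type) (R : A -> A -> Prop).

Definition quot : Type :=
  {C : A -> Prop | exists x, C = clos_refl_sym_trans A R x}.

Definition cls (x : A) : quot :=
  exist _ (clos_refl_sym_trans A R x) (ex_intro _ x erefl).

Definition repr (c : quot) : A := sval (cid (svalP c)).

Lemma reprK c : cls (repr c) = c.
Proof. by apply: sig_inj; rewrite /repr; case: cid. Qed.

Lemma cls_eq x y : R x y -> cls x = cls y.
Proof.
move=> xy; apply: sig_inj => /=; apply: funext => z; apply: propext.
split=> h; last by apply: rst_trans h; apply: rst_step.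
by apply: rst_trans h; apply: rst_sym; apply: rst_step.
Qed.

Lemma cls_rst x y : cls x = cls y -> clos_refl_sym_trans A R x y.
Proof. by case=> ->; apply: rst_refl. Qed.

Lemma quot_ind (P : quot -> Prop) : (forall x, P (cls x)) -> forall c, P c.
Proof. by move=> h c; rewrite -(reprK c). Qed.

End Quotient.

Section QuotientMap.
Variables (A B : Type) (R : A -> A -> Prop) (Q : B -> B -> Prop) (f : A -> B).

Definition quot_map (c : quot R) : quot Q := cls Q (f (repr c)).

Lemma quot_mapE (hf : forall x y, R x y -> Q (f x) (f y)) x :
  quot_map (cls R x) = cls Q (f x).
Proof.
rewrite /quot_map; move: (repr _) (cls_rst (reprK (cls R x))) => y.
by elim=> {x y} [x y xy|x|x y _ ->|x y z _ -> _ ->] //; apply/cls_eq/hf.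
Qed.

End QuotientMap.

(* In the nerve of a category [isomorphic] is already an equivalence relation,
   so [isoclasses S] is its set of isomorphism classes of objects; the
   equivalence closure only makes this a functor on all simplicial sets. *)
Definition isoclasses (S : psh simplex) : Type := quot (@isomorphic S).
Definition isocls (S : psh simplex) (x : S 0) : isoclasses S :=
  cls (@isomorphic S) x.

Definition isoclasses_map (S T : psh simplex) (F : nattr S T) :
  isoclasses S -> isoclasses T := quot_map (@isomorphic T) (F 0).

Lemma isoclasses_ind (S : psh simplex) (P : isoclasses S -> Prop) :
  (forall x, P (isocls x)) -> forall c, P c.
Proof. exact: quot_ind. Qed.

Lemma isoclasses_mapE (S T : psh simplex) (F : nattr S T) (x : S 0) :
  isoclasses_map F (isocls x) = isocls (F 0 x).
Proof. by apply: quot_mapE => y z; apply: isomorphic_nt. Qed.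

Section Slices.
Variable n : nat.

Lemma pmap_pair (X : msset n.+1) (s t : dpow n) (k l : simplex)
    (u v : hom s t) (phi psi : hom k l) (x : X (t, l)) :
  u = v -> phi = psi ->
  @pmap (dpow n.+1) X (s, k) (t, l) (u, phi) x =
  @pmap (dpow n.+1) X (s, k) (t, l) (v, psi) x.
Proof. by move=> -> ->. Qed.

(* X_k = X(k, -, ..., -) *)
Program Definition slice (X : msset n.+1) (k : nat) : msset n := {|
  pob := fun s => X (dcons k s);
  pmap := fun s t u => pmap X (dconsm (@idm simplex k) u) |}.
Next Obligation. by rewrite dconsm1 pmap1. Qed.
Next Obligation. by rewrite -pmapM -dconsmM cmp1m. Qed.

(* The map X_l -> X_k induced by phi : [k] -> [l]. *)
Program Definition slice_op (X : msset n.+1) (k l : nat)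
    (phi : @hom simplex k l) : nattr (slice X l) (slice X k) :=
  {| ntf := fun s => pmap X (dconsm phi (idm s)) |}.
Next Obligation. by rewrite -!pmapM -!dconsmM !cmp1m !cmpm1. Qed.

Program Definition slice_nt (X Y : msset n.+1) (f : nattr X Y) (k : nat) :
    nattr (slice X k) (slice Y k) :=
  {| ntf := fun s => f (dcons k s) |}.
Next Obligation. exact: ntP. Qed.

(* X(s_1, ..., s_n, -), the nerve of X_{s_1 ... s_n} when X is an
   (n+1)-fold category. *)
Program Definition row (X : msset n.+1) (s : dpow n) : psh simplex := {|
  pob := fun k => X (s, k);
  pmap := fun k l phi =>
    @pmap (dpow n.+1) X (s, k) (s, l) (idm s, phi) |}.
Next Obligation. exact: (@pmap1 (dpow n.+1)). Qed.
Next Obligation. by rewrite -(@pmapM (dpow n.+1)) /= cmp1m. Qed.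

Program Definition row_op (X : msset n.+1) (s t : dpow n) (u : hom s t) :
    nattr (row X t) (row X s) :=
  {| ntf := fun k => @pmap (dpow n.+1) X (s, k) (t, k) (u, @idm simplex k) |}.
Next Obligation.
rewrite -!(@pmapM (dpow n.+1)) /= cmp1m cmpm1.
by apply: pmap_pair => //; apply: sig_inj.
Qed.

Program Definition row_nt (X Y : msset n.+1) (f : nattr X Y) (s : dpow n) :
    nattr (row X s) (row Y s) :=
  {| ntf := fun k => f (s, k) |}.
Next Obligation. exact: (@ntP (dpow n.+1)). Qed.

(* p^(n+1) and d^(n+1) *)
Program Definition pn (X : msset n.+1) : msset n := {|
  pob := fun s => isoclasses (row X s);
  pmap := fun s t u => isoclasses_map (row_op X u) |}.
Next Obligation.
elim/isoclasses_ind: x => x; rewrite isoclasses_mapE /=; congr cls.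
exact: (@pmap1 (dpow n.+1)).
Qed.
Next Obligation.
elim/isoclasses_ind: x => x; rewrite !isoclasses_mapE; congr cls.
rewrite /= -(@pmapM (dpow n.+1)) /=.
by apply: pmap_pair => //; apply: sig_inj.
Qed.

Program Definition pn_nt (X Y : msset n.+1) (f : nattr X Y) :
    nattr (pn X) (pn Y) :=
  {| ntf := fun s => isoclasses_map (row_nt f s) |}.
Next Obligation.
elim/isoclasses_ind: x => x; rewrite !isoclasses_mapE; congr cls.
exact: (@ntP (dpow n.+1)).
Qed.

Program Definition dn (Y : msset n) : msset n.+1 := {|
  pob := fun s => Y s.1;
  pmap := fun s t u => pmap Y u.1 |}.
Next Obligation. exact: pmap1. Qed.
Next Obligation. exact: pmapM. Qed.

Program Definition dn_nt (X Y : msset n) (f : nattr X Y) :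
    nattr (dn X) (dn Y) :=
  {| ntf := fun s => f s.1 |}.
Next Obligation. exact: ntP. Qed.

End Slices.

Lemma row_slice n (X : msset n.+2) (k : nat) (s : dpow n) :
  row (slice X k) s = row X (dcons k s).
Proof. by apply: psh_eq => i j phi x /=; rewrite dconsm1. Qed.

(* The limit of s copies of A in which u on each copy is glued to v on the
   next one. *)
Section Glue.
Variables (C : cat) (A B : psh C) (u v : nattr A B) (s : nat).

Definition glued (r : C) (x : 'I_s -> A r) : Prop :=
  forall i j : 'I_s, j = i.+1 :> nat -> u r (x i) = v r (x j).

Program Definition glue : psh C := {|
  pob := fun r => {x : 'I_s -> A r | glued x};
  pmap := fun q r w x => exist _ (fun i => pmap A w (sval x i)) _ |}.
Next Obligation. by move=> i j ij; rewrite !ntP (svalP x i j ij). Qed.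
Next Obligation.
by apply: sig_inj; apply: funext => i /=; rewrite pmap1.
Qed.
Next Obligation.
by apply: sig_inj; apply: funext => i /=; rewrite pmapM.
Qed.

Program Definition glue_pr (i : 'I_s) : nattr glue A :=
  {| ntf := fun r x => sval x i |}.

Program Definition glue_pair (Z : psh C) (p : 'I_s -> nattr Z A)
    (hp : forall r z, glued (fun i => p i r z)) : nattr Z glue :=
  {| ntf := fun r z => exist _ (fun i => p i r z) (hp r z) |}.
Next Obligation.
by apply: sig_inj; apply: funext => i /=; rewrite ntP.
Qed.

End Glue.

Section Segal.
Variables (n : nat) (X : msset n.+1).

Definition d0 : nattr (slice X 1) (slice X 0) := slice_op X delta0.
Definition d1 : nattr (slice X 1) (slice X 0) := slice_op X delta1.

Definition nu (s : nat) (j : 'I_s) : nattr (slice X s) (slice X 1) :=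
  slice_op X (spine j).

Lemma nu_glued (s : nat) r (x : slice X s r) :
  glued d0 d1 (fun i : 'I_s => nu i r x).
Proof.
move=> i j ij; rewrite /= -!pmapM -!dconsmM !cmp1m.
rewrite edge_delta0 edge_delta1; congr (pmap X (dconsm (vertex _) _) x).
by apply: val_inj; rewrite /= /bump /= ij.
Qed.

Definition segal_map (s : nat) : nattr (slice X s) (glue d0 d1 s) :=
  glue_pair (@nu_glued s).

Definition segal : Prop := forall s, 2 <= s -> is_iso (segal_map s).

End Segal.

(* Cat^n_hd.  For n = 1: groupoids equivalent to a discrete category.  For
   n >= 2: since pn is levelwise, slice (pn X) k is p^(n-1)(X_k), so the last
   clause says that k |-> p^(n-1)(X_k) is an object of Cat^(n-1)_hd.  [segal] is the Segal
   condition in the first direction; in the other directions it comes from the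
   slices. *)
Fixpoint hd (n : nat) : msset n -> Prop :=
  match n return msset n -> Prop with
  | 0 => fun _ => True
  | m.+1 =>
    match m return (msset m -> Prop) -> msset m.+1 -> Prop with
    | 0 => fun _ X =>
        [/\ segal X, groupoid (row X tt)
          & exists (A : Type) (F : nattr (row X tt) (constp A)), equivalence F]
    | _.+1 => fun hd_m X =>
        [/\ forall k, hd_m (slice X k), segal X & hd_m (pn X)]
    end (@hd m)
  end.

Lemma hd_slice n (X : msset n.+2) (k : nat) : hd X -> hd (slice X k).
Proof. by case=> hX _ _; apply: hX. Qed.

Lemma hd_pn n (X : msset n.+1) : hd X -> hd (pn X).
Proof. by case: n X => [|n] X //; case. Qed.

Lemma hd_groupoid n (X : msset n.+1) (s : dpow n) : hd X -> groupoid (row X s).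
Proof.
elim: n X s => [|n IH] X s; first by case: s => -[].
move=> hX; have [k [t ->]] := dcons_surj s.
by rewrite -row_slice; apply/IH/hd_slice.
Qed.

(* gamma^(n+1).  A k-simplex of a row goes to the isomorphism class of its
   initial vertex; this is natural because rows are groupoids, so that all
   vertices of a simplex are isomorphic. *)
Definition gamma_fun n (X : msset n.+1) (s : dpow n.+1) (x : X s) :
    dn (pn X) s :=
  @isocls (row X s.1) (@pmap (dpow n.+1) X (s.1, 0) s
                         (idm s.1, vertex ord0) x).

Lemma gamma_natural n (X : msset n.+1) (hX : hd X) (s t : dpow n.+1)
    (u : hom s t) (x : X t) :
  gamma_fun (pmap X u x) = pmap (dn (pn X)) u (gamma_fun x).
Proof.
case: s t u x => [s k] [t l] [u phi] x.
rewrite /gamma_fun [RHS]isoclasses_mapE /= -!(@pmapM (dpow n.+1)) /=.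
rewrite cmp1m cmpm1; symmetry; apply: cls_eq.
pose e : row X s 1 := @pmap (dpow n.+1) X (s, 1) (t, l)
  (u, edge (leq0n (sval phi ord0) : @ord0 l <= sval phi ord0)) x.
exists e; split; last exact: hd_groupoid.
- rewrite /source /e /= -(@pmapM (dpow n.+1)) /= cmpm1.
  by apply: pmap_pair => //; apply: sig_inj; apply: funext => i; rewrite ord1.
- rewrite /target /e /= -(@pmapM (dpow n.+1)) /= cmpm1.
  by apply: pmap_pair => //; apply: sig_inj; apply: funext => i; rewrite ord1.
Qed.

Definition gamma n (X : msset n.+1) (hX : hd X) : nattr X (dn (pn X)) :=
  NatTr (gamma_natural hX).

(* X^d = d^(n) ... d^(1) p^(1) ... p^(n) X *)
Fixpoint disc (n : nat) : msset n -> msset n :=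
  match n return msset n -> msset n with
  | 0 => fun X => X
  | m.+1 => fun X => dn (disc (pn X))
  end.

Fixpoint disc_nt (n : nat) :
    forall X Y : msset n, nattr X Y -> nattr (disc X) (disc Y) :=
  match n return forall X Y : msset n, nattr X Y -> nattr (disc X) (disc Y)
  with
  | 0 => fun X Y f => f
  | m.+1 => fun X Y f => dn_nt (disc_nt (pn_nt f))
  end.

(* gamma_(n) : X -> X^d *)
Fixpoint disc_map (n : nat) : forall X : msset n, hd X -> nattr X (disc X) :=
  match n return forall X : msset n, hd X -> nattr X (disc X) with
  | 0 => fun X _ => ntid X
  | m.+1 => fun X hX => ntcomp (dn_nt (disc_map (hd_pn hX))) (gamma hX)
  end.

Lemma disc_map_natural n (X Y : msset n) (hX : hd X) (hY : hd Y)
    (f : nattr X Y) (s : dpow n) (x : X s) :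
  disc_map hY s (f s x) = disc_nt f s (disc_map hX s x).
Proof.
elim: n X Y hX hY f s x => [|n IH] X Y hX hY f s x //=.
rewrite -(IH _ _ (hd_pn hX) (hd_pn hY)); congr (disc_map _ _ _).
by rewrite /gamma_fun [RHS]isoclasses_mapE /= (@ntP (dpow n.+1)).
Qed.

(* An element of the underlying set of the discrete (n+1)-fold category X_0^d
   is taken to be a point of X_0^d(0, ..., 0); [at_level] is its image in
   X_0^d(s_1, ..., s_(n+1)). *)
Definition points (n : nat) (X : msset n.+2) : Type :=
  disc (slice X 0) (dzero n.+1).

Definition at_level n (X : msset n.+2) (a : points X) (s : dpow n.+1) :
    disc (slice X 0) s :=
  pmap (disc (slice X 0)) (dto0 s) a.

Definition points_map n (X Y : msset n.+2) (f : nattr X Y) :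
  points X -> points Y := disc_nt (slice_nt f 0) (dzero n.+1).

Section Fiber.
Variables (n : nat).

(* gamma_(n+1) : X_0 -> X_0^d *)
Definition gamma0 (X : msset n.+2) (hX : hd X) :
  nattr (slice X 0) (disc (slice X 0)) := disc_map (hd_slice 0 hX).

Definition in_fiber (X : msset n.+2) (hX : hd X) (a b : points X)
    (s : dpow n.+1) (x : slice X 1 s) : Prop :=
  gamma0 hX s (d0 X s x) = at_level a s /\
  gamma0 hX s (d1 X s x) = at_level b s.

(* X(a, b) *)
Program Definition fiber (X : msset n.+2) (hX : hd X) (a b : points X) :
    msset n.+1 := {|
  pob := fun s => {x : slice X 1 s | in_fiber hX a b x};
  pmap := fun s t u x => exist _ (pmap (slice X 1) u (sval x)) _ |}.
Next Obligation.
case: (svalP x) => xa xb; split; rewrite !ntP ?xa ?xb /at_level -pmapM;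
  by congr (pmap _ _ _); apply: dto0_uniq.
Qed.
Next Obligation. by apply: sig_inj; apply: (@pmap1 _ (slice X 1)). Qed.
Next Obligation. by apply: sig_inj; apply: (@pmapM _ (slice X 1)). Qed.

(* f(a, b) : X(a, b) -> Y(f a, f b) *)
Program Definition fiber_nt (X Y : msset n.+2) (hX : hd X) (hY : hd Y)
    (f : nattr X Y) (a b : points X) :
    nattr (fiber hX a b) (fiber hY (points_map f a) (points_map f b)) :=
  {| ntf := fun s x => exist _ (slice_nt f 1 s (sval x)) _ |}.
Next Obligation.
have opn phi : slice_op Y phi s (slice_nt f 1 s (sval x)) =
               slice_nt f 0 s (slice_op X phi s (sval x)).
  by rewrite /= ntP.
case: (svalP x) => xa xb; split;
  rewrite /gamma0 opn (disc_map_natural (hd_slice 0 hX)) ?[disc_map _ _ _]xa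
    ?[disc_map _ _ _]xb; exact: ntP.
Qed.
Next Obligation. by apply: sig_inj; apply: (ntP (slice_nt f 1)). Qed.

End Fiber.

(* [n_equivalence] includes that source and target lie in Cat^n_hd.
   The clause for 0 is only there to make the definition total. *)
Fixpoint n_equivalence (n : nat) :
    forall X Y : msset n, nattr X Y -> Prop :=
  match n return forall X Y : msset n, nattr X Y -> Prop with
  | 0 => fun X Y f => is_iso f
  | m.+1 =>
    match m return (forall X Y : msset m, nattr X Y -> Prop) ->
                   forall X Y : msset m.+1, nattr X Y -> Prop with
    | 0 => fun _ X Y f => [/\ hd X, hd Y & equivalence (row_nt f tt)]
    | _.+1 => fun equiv_m X Y f =>
        exists (hX : hd X) (hY : hd Y),
          (forall a b : points X, equiv_m _ _ (fiber_nt hX hY f a b)) /\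
          equiv_m _ _ (pn_nt f)
    end (@n_equivalence m)
  end.

Section InducedSegal.
Variables (n : nat) (X : msset n.+2) (hX : hd X) (s : nat).

(* X_1 x_{X_0^d} ... x_{X_0^d} X_1 *)
Definition disc_glue : msset n.+1 :=
  glue (ntcomp (gamma0 hX) (d0 X)) (ntcomp (gamma0 hX) (d1 X)) s.

Lemma glue_to_disc_glued r (x : glue (d0 X) (d1 X) s r) :
  glued (ntcomp (gamma0 hX) (d0 X)) (ntcomp (gamma0 hX) (d1 X))
    (fun i => glue_pr (d0 X) (d1 X) i r x).
Proof. by move=> i j ij; apply: (congr1 (gamma0 hX r) (svalP x i j ij)). Qed.

Definition glue_to_disc_glue : nattr (glue (d0 X) (d1 X) s) disc_glue :=
  glue_pair glue_to_disc_glued.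

Definition induced_segal_map : nattr (slice X s) disc_glue :=
  ntcomp glue_to_disc_glue (segal_map X s).

Lemma induced_segal_mapP (j : 'I_s) r (x : slice X s r) :
  glue_pr (ntcomp (gamma0 hX) (d0 X)) (ntcomp (gamma0 hX) (d1 X)) j r
    (induced_segal_map r x) = nu X j r x.
Proof. by []. Qed.

End InducedSegal.

(* Main.v *)
From mathcomp Require Import all_boot.
From mathcomp Require Import boolp.
Require Import Defs.

(** An object [X] of Cat^n_hd carries no more information, up to
    n-equivalence, than the set [X^d], and the whole proof consists in working
    on these sets.  For [X] in Cat^n_hd with [n >= 1], the sets [(X_k)^d]
    form a simplicial set, [disc_nerve X], and it is the nerve of an equivalence
    relation on [X_0^d] (lemma [relation_nerve_disc_nerve]): since [(X_k)^d] is
    also [(p(X)_k)^d] when [n >= 2], this goes down by induction to the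
    dimension 1, where [disc_nerve X] is the nerve of [X] itself.

    The fibre [X(a, b)] is a union of components of [X_1], so [X(a, b)^d] is
    the set of edges of [disc_nerve X] between [b] and [a]: it has at most one
    element, and it has one exactly when [a] and [b] are related.  By induction
    a map [f] of Cat^n_hd is therefore an n-equivalence as soon as it
    is a bijection [X^d -> Y^d] (lemma [n_equivalence_of_disc_bij]): the fibres
    are matched because [a] and [b] are related if and only if they have the
    same image in [X^d], and [p(f)] has the same discretization as [f].

    For the induced Segal map, the elements of the discretization of the glued
    product are strings of [s] composable edges of [disc_nerve X], because the
    product is glued over a discrete object.  So the map of discretizations
    is the Segal map of [disc_nerve X], a bijection since [disc_nerve X] is the
    nerve of a category.

    Fibres and glued products are also shown to lie in Cat^n_hd, and their
    discretizations to embed into the expected products, by a single criterion: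
    they are unions of components of a product of objects of Cat^n_hd, which is
    what [clopen_cone] expresses. *)

Set Implicit Arguments.
Unset Strict Implicit.
Unset Printing Implicit Defensive.

(** * Natural transformations *)

Lemma nattr_eq (C : cat) (X Y : psh C) (f g : nattr X Y) :
  (forall s x, f s x = g s x) -> f = g.
Proof.
case: f g => [f fP] [g gP] /= fg; have efg : f = g.
  by apply: functional_extensionality_dep => s; apply: funext => x.
by case: _ / efg gP {fg} => gP; rewrite (Prop_irrelevance fP gP).
Qed.

Lemma is_isoP (C : cat) (X Y : psh C) (f : nattr X Y) :
  is_iso f <->
  (forall s, injective (f s)) /\ (forall s y, exists x, f s x = y).
Proof.
split=> [[g [fK gK]]|[f_inj f_surj]].
  by split=> [s|s y]; [apply: can_inj (fK s) | exists (g s y)].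
pose g s y : X s := sval (cid (f_surj s y)).
have gK s y : f s (g s y) = y by rewrite /g; case: cid.
have gP s t (u : hom s t) (y : Y t) : g s (pmap Y u y) = pmap X u (g t y).
  by apply: f_inj; rewrite ntP !gK.
by exists (NatTr gP); split=> // s x; apply: f_inj; rewrite gK.
Qed.

(** * Nerves of equivalence relations *)

Definition vert (S : psh simplex) k (i : 'I_k.+1) (x : S k) : S 0 :=
  pmap S (vertex i) x.

Definition related (S : psh simplex) (x y : S 0) : Prop :=
  exists f : S 1, source f = x /\ target f = y.

(** A simplicial set of this kind is the nerve of the equivalence relation
    [related]: its k-simplices are the (k+1)-tuples of pairwise related
    vertices.  This form of the axioms for Cat_hd mentions neither composition
    nor inverses, so that it passes easily to products and unions of
    components. *)
Record relation_nerve (S : psh simplex) : Prop := RelationNerve {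
  vert_inj : forall k (x y : S k),
    (forall i, vert i x = vert i y) -> x = y;
  vert_fill : forall k (v : 'I_k.+1 -> S 0),
    (forall i j, related (v i) (v j)) ->
    exists x : S k, forall i, vert i x = v i;
  related_sym : forall x y : S 0, related x y -> related y x;
  related_trans : forall x y z : S 0,
    related x y -> related y z -> related x z }.

Section Simplices.
Variable S : psh simplex.

Lemma vert_pmap k l (phi : @hom simplex k l) (i : 'I_k.+1) (x : S l) :
  vert i (pmap S phi x) = vert (sval phi i) x.
Proof.
rewrite /vert -pmapM; congr (pmap S _ x).
by apply: sig_inj; apply: funext => j.
Qed.

Lemma vert0 (x : S 0) i : vert i x = x.
Proof.
rewrite /vert (_ : vertex i = idm (c0 := simplex) 0) ?pmap1 //.
exact: to0_uniq.
Qed.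

Lemma source_vert (f : S 1) : source f = vert ord0 f.
Proof.
rewrite /source /vert; congr (pmap S _ f).
by apply: sig_inj; apply: funext => j; rewrite ord1; apply: val_inj.
Qed.

Lemma target_vert (f : S 1) : target f = vert ord_max f.
Proof.
rewrite /target /vert; congr (pmap S _ f).
by apply: sig_inj; apply: funext => j; rewrite ord1; apply: val_inj.
Qed.

Lemma ord2P (i : 'I_2) : i = ord0 \/ i = ord_max.
Proof.
by case: i => -[|[|//]] h; [left | right]; apply: val_inj.
Qed.

Lemma related_refl (x : S 0) : related x x.
Proof.
by exists (ident x); rewrite source_vert target_vert /ident !vert_pmap !vert0.
Qed.

Lemma related_vert_le k (x : S k) (i j : 'I_k.+1) :
  i <= j -> related (vert i x) (vert j x).
Proof.
move=> ij; exists (pmap S (edge ij) x).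
by rewrite source_vert target_vert !vert_pmap.
Qed.

Lemma tri_subproof k (i j l : 'I_k.+1) : i <= j -> j <= l ->
  mono (fun m : 'I_3 =>
    if m == 0 :> nat then i else if m == 1 :> nat then j else l).
Proof.
move=> ij jl; have il := leq_trans ij jl.
by case=> [[|[|[|//]]] h1] [[|[|[|//]]] h2].
Qed.

(** The operator [2] -> [k] with values [i], [j], [l]; it exhibits the edge from
    [i] to [l] of any k-simplex as a composite. *)
Definition tri k (i j l : 'I_k.+1) (ij : i <= j) (jl : j <= l) :
    @hom simplex 2 k := exist _ _ (tri_subproof ij jl).

Lemma composes_edges k (x : S k) (i j l : 'I_k.+1)
    (ij : i <= j) (jl : j <= l) (il : i <= l) :
  composes (pmap S (edge ij) x) (pmap S (edge jl) x) (pmap S (edge il) x).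
Proof.
exists (pmap S (tri ij jl) x); rewrite -!pmapM.
by split; congr (pmap S _ x); apply: sig_inj; apply: funext => m /=;
  case: (ord2P m) => -> //=; rewrite /= inordK.
Qed.

(** [fillable] and [spine_inj] are the surjectivity and the injectivity of the
    Segal maps of a simplicial set. *)
Definition fillable : Prop := forall s (e : 'I_s -> S 1), 2 <= s ->
  (forall i j : 'I_s, j = i.+1 :> nat -> target (e i) = source (e j)) ->
  exists x : S s, forall i, pmap S (spine i) x = e i.

Definition spine_inj : Prop := forall s (x y : S s), 2 <= s ->
  (forall i : 'I_s, pmap S (spine i) x = pmap S (spine i) y) -> x = y.

Lemma vert_spine_src s (i : 'I_s) (x : S s) :
  source (pmap S (spine i) x) = vert (widen_ord (leqnSn s) i) x.
Proof. by rewrite source_vert vert_pmap. Qed.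

Lemma vert_spine_tgt s (i : 'I_s) (x : S s) :
  target (pmap S (spine i) x) = vert (lift ord0 i) x.
Proof. by rewrite target_vert vert_pmap. Qed.

Lemma eq_vert_spine s (x y : S s) : 0 < s ->
  (forall i : 'I_s, pmap S (spine i) x = pmap S (spine i) y) ->
  forall i, vert i x = vert i y.
Proof.
move=> s0 xy i; have [->|[j ->]] : i = widen_ord (leqnSn s) (Ordinal s0) \/
    exists j, i = lift ord0 j.
  case: (unliftP ord0 i) => [j|] ->; first by right; exists j.
  by left; apply: val_inj.
- by rewrite -!vert_spine_src xy.
- by rewrite -!vert_spine_tgt xy.
Qed.

End Simplices.

Lemma segal_fillable (X : msset 1) :
  segal X <-> fillable (row X tt) /\ spine_inj (row X tt).
Proof.
split=> [sX|[fX iX] s s2].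
  split=> [s e s2 he|s x y s2 xy]; have /is_isoP [inj surj] := sX _ s2.
    have ge : @glued _ _ _ (d0 X) (d1 X) s tt e by move=> i j ij; apply: he.
    have [x xe] := surj tt (exist _ e ge); exists x => i.
    exact: (congr1 (fun w => sval w i) xe).
  by apply: (inj tt); apply: sig_inj; apply: funext => i; apply: xy.
apply/is_isoP; split=> -[] => [x y xy|[e ge]].
  by apply: iX => // i; apply: (congr1 (fun w => sval w i) xy).
have [x xe] := fX s e s2 ge; exists x.
by apply: sig_inj; apply: funext => i; apply: xe.
Qed.

(** * Groupoids equivalent to a discrete category *)

Section FromCategory.
Variable S : psh simplex.

Lemma composes_ends (f g h : S 1) : composes f g h ->
  [/\ target f = source g, source h = source f & target h = target g].
Proof.
case=> c [<- <- <-]; rewrite !source_vert !target_vert !vert_pmap.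
by split; congr (vert _ c); apply: val_inj; rewrite /= !inordK.
Qed.

Lemma composes_ident (f : S 1) : composes (ident (source f)) f f.
Proof.
exists (pmap S (tri (leqnn ord0) (leq0n (@ord_max 1) : @ord0 1 <= ord_max)) f).
rewrite /ident /source -!pmapM.
split; [|rewrite -[RHS]pmap1|rewrite -[RHS]pmap1];
  congr (pmap S _ f);
  apply: sig_inj; apply: funext => m /=;
  by case: (ord2P m) => -> /=; apply: val_inj; rewrite /= ?inordK.
Qed.

Hypotheses (S_fill : fillable S) (S_inj : spine_inj S).

Lemma spine2 (c : S 2) (i : 'I_2) :
  pmap S (spine i) c =
  pmap S (if i == ord0 then coface (inord 2) else coface (inord 0)) c.
Proof.
congr (pmap S _ c); case: (ord2P i) => ->; apply: sig_inj; apply: funext => m;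
  by case: (ord2P m) => -> /=; apply: val_inj; rewrite /= ?inordK.
Qed.

Lemma composes_uniq (f g h h' : S 1) :
  composes f g h -> composes f g h' -> h = h'.
Proof.
case=> c [cf cg <-] [c' [cf' cg' <-]]; congr (pmap S _ _).
by apply: S_inj => // i; rewrite !spine2; case: ifP => _; congruence.
Qed.

(** A composite with an invertible [a] can be undone by the inverse [b] of [a];
    associativity is read off the 3-simplex with spine [b], [a], [f]. *)
Lemma composes_cancel (a f g h : S 1) : invertible a ->
  composes a f h -> composes a g h -> f = g.
Proof.
case=> b [_ ba].
suff inv k : composes a k h -> composes b h k.
  by move=> /inv fh /inv gh; apply: composes_uniq fh gh.
move=> ak; have [tb _ _] := composes_ends ba; have [ta _ _] := composes_ends ak.
(* The edges of the 3-simplex [x] are b = 01, a = 12, k = 23, h = 13, an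
   identity for 02, and hence k for 03. *)
have [|x xe] := S_fill (e := fun i : 'I_3 => nth b [:: b; a; k] i) isT.
  by do 2![case=> -[|[|[|//]]] ?].
have xE (i j : 'I_4) (ij : i <= j) (ji : j = i.+1 :> nat) :
    pmap S (edge ij) x = nth b [:: b; a; k] i.
  have i3 : i < 3 by rewrite -ltnS -ji ltn_ord.
  rewrite -(xe (Ordinal i3)); congr (pmap S _ x).
  apply: sig_inj; apply: funext => m /=.
  by case: (ord2P m) => -> /=; apply: val_inj.
pose o i (h : i < 4) := Ordinal h.
have cE i j l (hi : i < 4) (hj : j < 4) (hl : l < 4) (ij : i <= j) (jl : j <= l)
    (il : i <= l) := @composes_edges S 3 x (o i hi) (o j hj) (o l hl) ij jl il.
have := cE 1 2 3 isT isT isT isT isT isT; rewrite xE // xE //=.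
move=> /composes_uniq/(_ ak) e13.
have := cE 0 1 2 isT isT isT isT isT isT; rewrite xE // xE //=.
move=> /composes_uniq/(_ ba) e02.
have := cE 0 2 3 isT isT isT isT isT isT; rewrite e02 xE //= ta.
move=> /composes_uniq/(_ (composes_ident k)) e03.
by have := cE 0 1 3 isT isT isT isT isT isT; rewrite e13 e03 xE.
Qed.

(** Parallel edges [f] and [g] have the same image under [F], hence under [G F];
    naturality of the isomorphism from [G F] to the identity then gives
    [f] and [g] the same composite with an invertible edge. *)
Lemma thin_of_equivalence (A : Type) (F : nattr S (constp A)) :
  equivalence F -> forall f g : S 1,
  source f = source g -> target f = target g -> f = g.
Proof.
case=> G [[alpha [alphaP alphaN]] _] f g sfg tfg.
have FE k : F 1 k = F 0 (source k) by rewrite -source_nt.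
have [h [fh1 fh2]] := alphaN f; have [h' [gh1 gh2]] := alphaN g.
have hh' : h = h'.
  move: fh1 gh1; rewrite /= !FE sfg tfg => fh1 gh1.
  exact: composes_uniq fh1 gh1.
have [_ _ inv] := alphaP (source f).
by apply: composes_cancel inv fh2 _; rewrite sfg hh'.
Qed.

Lemma relation_nerve_thin : groupoid S ->
  (forall f g : S 1, source f = source g -> target f = target g -> f = g) ->
  relation_nerve S.
Proof.
move=> S_gpd thin.
have thinv (f g : S 1) : (forall i, vert i f = vert i g) -> f = g.
  by move=> fg; apply: thin; rewrite ?source_vert ?target_vert.
split.
- case=> [|[|k]] x y xy; first by rewrite -(vert0 x ord0) xy vert0.
    exact: thinv.
  by apply: S_inj => // i; apply: thinv => j; rewrite !vert_pmap.
- case=> [|[|k]] v vR.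
  + by exists (v ord0) => i; rewrite ord1 vert0.
  + have [f [fs ft]] := vR ord0 ord_max; exists f => i.
    by case: (ord2P i) => ->; rewrite -?source_vert -?target_vert.
  + pose e (i : 'I_k.+2) := cid (vR (widen_ord (leqnSn _) i) (lift ord0 i)).
    have [|x xe] := S_fill (e := fun i => sval (e i)) isT.
      move=> i j ij; rewrite /e.
      case: cid => f [_ /= ->]; case: cid => g [/= -> _].
      by congr v; apply: val_inj; rewrite /= /bump /= ij.
    exists x => i; case: (unliftP ord0 i) => [j|] ->.
      by rewrite -vert_spine_tgt xe /e; case: cid => f [_ /= ->].
    have -> : ord0 = widen_ord (leqnSn k.+2) ord0 by apply: val_inj.
    by rewrite -vert_spine_src xe /e; case: cid => f [/= -> _].
- move=> x y [f [<- <-]]; have [g [/composes_ends [fg _ gf] _]] := S_gpd f.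
  exists g; split=> //; move: gf => <-.
  by rewrite target_vert /ident vert_pmap vert0.
- move=> x y z [f [<- fy]] [g [gy <-]].
  have [|c ce] := S_fill (e := fun i : 'I_2 => nth f [:: f; g] i) isT.
    by do 2![case=> -[|[|//]] ?]; rewrite //= fy gy.
  have := ce ord0; have := ce ord_max => /= eg ef.
  exists (pmap S (edge (leq0n (@ord_max 2) : @ord0 2 <= ord_max)) c).
  rewrite -eg -ef !source_vert !target_vert !vert_pmap.
  by split; congr (vert _ c); apply: val_inj.
Qed.

End FromCategory.

Section ToCategory.
Variables (S : psh simplex) (S_rel : relation_nerve S).

Lemma edge_eq (f g : S 1) : source f = source g -> target f = target g -> f = g.
Proof.
move=> sfg tfg; apply: (vert_inj S_rel) => i.
by case: (ord2P i) => ->; rewrite -?source_vert -?target_vert.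
Qed.

Lemma related_vert k (x : S k) (i j : 'I_k.+1) : related (vert i x) (vert j x).
Proof.
have [ij|/ltnW ij] := leqP i j; first exact: related_vert_le.
by apply: (related_sym S_rel); apply: related_vert_le.
Qed.

Lemma relation_nerve_spine_inj : spine_inj S.
Proof.
move=> s x y s2 xy; apply: (vert_inj S_rel).
by apply: eq_vert_spine => //; apply: leq_trans s2.
Qed.

Lemma relation_nerve_fillable : fillable S.
Proof.
move=> s e s2 ge; have s0 : 0 < s by apply: leq_trans s2.
pose v (i : 'I_s.+1) :=
  if unlift ord0 i is Some j then target (e j) else source (e (Ordinal s0)).
have vS i : v (lift ord0 i) = target (e i) by rewrite /v liftK.
have vW i : v (widen_ord (leqnSn s) i) = source (e i).
  rewrite /v; case: unliftP => [j /(congr1 val)|/(congr1 val)] /=.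
    by move=> ij; apply: ge.
  by move=> i0; congr (source (e _)); apply: val_inj.
have v0 i : related (v ord0) (v i).
  case: i => i; elim: i => [|i IH] hi.
    by rewrite (_ : Ordinal hi = ord0); [apply: related_refl | apply: val_inj].
  apply: (related_trans S_rel) (IH (ltnW hi)) _; have his : i < s := hi.
  exists (e (Ordinal his)); rewrite -vS -vW.
  by split; congr v; apply: val_inj.
have [|x xv] := vert_fill S_rel (v := v).
  move=> i j; apply: (related_trans S_rel) (v0 j).
  exact: (related_sym S_rel).
exists x => i; apply: edge_eq.
  by rewrite vert_spine_src xv vW.
by rewrite vert_spine_tgt xv vS.
Qed.

Lemma composes_of_ends (f g h : S 1) : target f = source g ->
  source h = source f -> target h = target g -> composes f g h.
Proof.
move=> fg sh th.
have [|c ce] :=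
  relation_nerve_fillable (e := fun i : 'I_2 => nth f [:: f; g] i) isT.
  by do 2![case=> -[|[|//]] ?].
have := ce ord0; have := ce ord_max; rewrite !spine2 /= => cg cf.
exists c; split=> //; apply: edge_eq.
  rewrite sh -cf !source_vert !vert_pmap.
  by congr (vert _ c); apply: val_inj; rewrite /= !inordK.
rewrite th -cg !target_vert !vert_pmap.
by congr (vert _ c); apply: val_inj; rewrite /= !inordK.
Qed.

Lemma source_ident (x : S 0) : source (ident x) = x.
Proof. by rewrite source_vert /ident vert_pmap vert0. Qed.

Lemma target_ident (x : S 0) : target (ident x) = x.
Proof. by rewrite target_vert /ident vert_pmap vert0. Qed.

Lemma relation_nerve_groupoid : groupoid S.
Proof.
move=> f.
have [|g [gs gt]] := related_sym S_rel (x := source f) (y := target f).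
  by exists f.
by exists g; split; apply: composes_of_ends;
  rewrite ?source_ident ?target_ident.
Qed.

Lemma isocls_eq (x y : S 0) : isocls x = isocls y <-> related x y.
Proof.
split=> [e|[f [fs ft]]].
  elim: (cls_rst e) => {x y e} [x y [f [fs ft _]]|x|x y _|x y z _ xy _ yz].
  - by exists f.
  - exact: related_refl.
  - exact: related_sym.
  - exact: related_trans xy yz.
by apply: cls_eq; exists f; split=> //; apply: relation_nerve_groupoid.
Qed.

(** Between maps into the nerve of an equivalence relation naturality is
    automatic, because parallel edges are equal. *)
Lemma related_natiso (T : psh simplex) (F G : nattr T S) :
  (forall x, related (F 0 x) (G 0 x)) -> naturally_isomorphic F G.
Proof.
move=> FG; exists (fun x => sval (cid (FG x))); split=> [x|f].
  by case: cid => f [/= fs ft]; split=> //; apply: relation_nerve_groupoid.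
case: cid => a [/= as_ at_]; case: cid => b [/= bs bt].
have [h [hs ht]] : related (F 0 (source f)) (G 0 (target f)).
  apply: (related_trans S_rel) (FG _).
  by exists (F 1 f); rewrite source_nt target_nt.
by exists h; split; apply: composes_of_ends;
  rewrite ?source_nt ?target_nt ?hs ?ht ?as_ ?at_ ?bs ?bt.
Qed.

End ToCategory.

Lemma related_nt (S T : psh simplex) (F : nattr S T) (x y : S 0) :
  related x y -> related (F 0 x) (F 0 y).
Proof. by case=> f [<- <-]; exists (F 1 f); rewrite source_nt target_nt. Qed.

Lemma vert_nt (S T : psh simplex) (F : nattr S T) k (i : 'I_k.+1) (x : S k) :
  vert i (F k x) = F 0 (vert i x).
Proof. by rewrite /vert ntP. Qed.

Lemma relation_nerve_const (A : Type) : relation_nerve (constp A).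
Proof.
have relE (x y : constp A 0) : related x y -> x = y by case=> f [<- <-].
split=> [k x y xy|k v hv|x y /relE ->|x y z /relE -> /relE ->].
- exact: (xy ord0).
- by exists (v ord0) => i; apply: (relE _ _ (hv ord0 i)).
- exact: (@related_refl (constp A)).
- exact: (@related_refl (constp A)).
Qed.

(** A quasi-inverse is chosen on vertices; it preserves [related], so it extends
    uniquely to all simplices. *)
Lemma equivalence_of_bij (S T : psh simplex) (F : nattr S T) :
  relation_nerve S -> relation_nerve T ->
  (forall x y, related (F 0 x) (F 0 y) -> related x y) ->
  (forall y, exists x, related (F 0 x) y) -> equivalence F.
Proof.
move=> S_rel T_rel F_full F_surj.
pose g y := sval (cid (F_surj y)).
have gP y : related (F 0 (g y)) y by rewrite /g; case: cid.
have gR y y' : related y y' -> related (g y) (g y').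
  move=> yy'; apply: F_full; apply: (related_trans T_rel (gP y)).
  apply: (related_trans T_rel yy').
  exact: (related_sym T_rel).
have fill k (y : T k) : exists x : S k, forall i, vert i x = g (vert i y).
  by apply: (vert_fill S_rel) => i j; apply/gR/related_vert.
pose G k y := sval (cid (@fill k y)).
have GP k y i : vert i (G k y) = g (vert i y) by rewrite /G; case: cid.
have GN k l (u : @hom simplex k l) y : G k (pmap T u y) = pmap S u (G l y).
  by apply: (vert_inj S_rel) => i; rewrite GP !vert_pmap GP.
have G0 y : G 0 y = g y by rewrite -[LHS](vert0 _ ord0) GP vert0.
exists (@NatTr simplex T S G GN); split; apply: related_natiso => // x /=.
  by apply: F_full; rewrite G0.
by rewrite G0.
Qed.

(** The discrete category to which [X] is equivalent can be taken to be its set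
    of isomorphism classes. *)
Lemma hd1P (X : msset 1) : hd X <-> relation_nerve (row X tt).
Proof.
split=> [[/segal_fillable [fX iX] gX [A [F eF]]]|S_rel].
  by apply: relation_nerve_thin => //; apply: thin_of_equivalence eF.
split.
- apply/segal_fillable; split; first exact: relation_nerve_fillable.
  exact: relation_nerve_spine_inj.
- exact: relation_nerve_groupoid.
set S := row X tt in S_rel *; exists (isoclasses S).
have FN k l (u : @hom simplex k l) (x : S l) :
    isocls (vert ord0 (pmap S u x)) = isocls (vert ord0 x).
  by apply/isocls_eq => //; rewrite vert_pmap; apply: related_vert.
pose F := @NatTr _ S (constp (isoclasses S)) _ FN.
exists F; apply: equivalence_of_bij => // [|x y|y].
- exact: relation_nerve_const.
- case=> f [fx fy]; have e := etrans (esym fx) fy.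
  by apply/isocls_eq => //; move: e; rewrite -[LHS]/(isocls (vert ord0 x))
    -[RHS]/(isocls (vert ord0 y)) !vert0.
- elim/isoclasses_ind: y => x; exists x.
  by rewrite -[F 0 x]/(isocls (vert ord0 x)) vert0; apply: related_refl.
Qed.

Lemma hd_relation_nerve n (X : msset n.+1) (s : dpow n) :
  hd X -> relation_nerve (row X s).
Proof.
elim: n X s => [|n IH] X s; first by case: s => /hd1P.
move=> hX; have [k [t ->]] := dcons_surj s.
by rewrite -row_slice; apply/IH/hd_slice.
Qed.

(** * Unions of components of products *)

(** [Y] is a union of connected components of the product of the [A i]: the
    maps [p i] embed it there, and a family belongs to [Y] as soon as one of its
    restrictions does (the converse being naturality).  The product itself is
    never formed. *)
Record clopen_cone (C : cat) (I : Type) (A : I -> psh C) (Y : psh C)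
    (p : forall i, nattr Y (A i)) : Prop := ClopenCone {
  cone_inj : forall s (y y' : Y s), (forall i, p i s y = p i s y') -> y = y';
  cone_clopen : forall s t (u : hom s t) (y : Y s) (x : forall i, A i t),
    (forall i, p i s y = pmap (A i) u (x i)) ->
    exists y' : Y t, forall i, p i t y' = x i }.

Lemma clopen_cone_row n (I : Type) (A : I -> msset n.+1) (Y : msset n.+1)
    (p : forall i, nattr Y (A i)) (s : dpow n) :
  clopen_cone p -> clopen_cone (fun i => row_nt (p i) s).
Proof.
move=> hp; split=> [k y y'|k l u y x yx]; first exact: (cone_inj hp).
exact: (@cone_clopen _ _ _ _ _ hp (s, k) (s, l) (idm s, u) y x yx).
Qed.

Lemma clopen_cone_slice n (I : Type) (A : I -> msset n.+1) (Y : msset n.+1)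
    (p : forall i, nattr Y (A i)) (k : nat) :
  clopen_cone p -> clopen_cone (fun i => slice_nt (p i) k).
Proof.
move=> hp; split=> [s y y'|s t u y x yx]; first exact: (cone_inj hp).
exact: (@cone_clopen _ _ _ _ _ hp _ _ (dconsm (@idm simplex k) u) y x yx).
Qed.

Section ConeNerve.
Variables (I : Type) (A : I -> psh simplex) (Y : psh simplex).
Variables (p : forall i, nattr Y (A i)) (hp : clopen_cone p).
Hypothesis hA : forall i, relation_nerve (A i).

(** A family of simplices of the [A i] lies in [Y] once its vertices do, and one
    vertex is enough. *)
Lemma cone_vert k (v : 'I_k.+1 -> Y 0) (x : forall i, A i k) :
  (forall i j, vert j (x i) = p i 0 (v j)) ->
  exists y : Y k, (forall i, p i k y = x i) /\ forall j, vert j y = v j.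
Proof.
move=> xv.
have [|y yx] := cone_clopen hp (u := vertex ord0) (y := v ord0) (x := x).
  by move=> i; rewrite -xv.
exists y; split=> // j; apply: (cone_inj hp) => i.
by rewrite -vert_nt yx xv.
Qed.

Lemma cone_related (x y : Y 0) :
  (forall i, related (p i 0 x) (p i 0 y)) -> related x y.
Proof.
move=> xy; pose f i := sval (cid (xy i)).
have [|e [_ ev]] := @cone_vert 1 (fun j => if j == ord0 then x else y) f.
  move=> i j; rewrite /f; case: cid => g [/= gs gt].
  by case: (ord2P j) => -> /=; rewrite -?source_vert -?target_vert.
by exists e; rewrite source_vert target_vert !ev.
Qed.

Lemma relation_nerve_cone : relation_nerve Y.
Proof.
split=> [k x y xy|k v vR|x y xy|x y z xy yz].
- apply: (cone_inj hp) => i; apply: (vert_inj (hA i)) => j.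
  by rewrite !vert_nt xy.
- have fill i : exists x : A i k, forall j, vert j x = p i 0 (v j).
    by apply: (vert_fill (hA i)) => j l; apply: related_nt.
  have [|y [_ yv]] := @cone_vert k v (fun i => sval (cid (fill i))).
    by move=> i j; case: cid.
  by exists y.
- by apply: cone_related => i; apply/(related_sym (hA i))/related_nt.
- by apply: cone_related => i;
    apply: (related_trans (hA i)) (related_nt _ xy) (related_nt _ yz).
Qed.

End ConeNerve.

(** The isomorphism classes of a product of nerves of equivalence relations are
    the families of isomorphism classes, and an isomorphism starting in a union
    of components stays in it. *)
Lemma clopen_cone_pn n (I : Type) (A : I -> msset n.+1) (Y : msset n.+1)
    (p : forall i, nattr Y (A i)) : (forall i, hd (A i)) ->
  clopen_cone p -> clopen_cone (fun i => pn_nt (p i)).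
Proof.
move=> hA hp; have rA i s := hd_relation_nerve s (hA i).
have hr s := clopen_cone_row s hp.
have rY s : relation_nerve (row Y s) := relation_nerve_cone (hr s) (rA^~ s).
split=> [s|s t u].
  elim/isoclasses_ind => y; elim/isoclasses_ind => y' yy'.
  apply/isocls_eq => //; apply: (cone_related (hr s)) => i.
  by apply/isocls_eq; rewrite // -!isoclasses_mapE; apply: yy'.
elim/isoclasses_ind => y x yx.
pose x' i : A i (t, 0) := repr (x i).
have x'x i : isocls (S := row (A i) t) (x' i) = x i := reprK (x i).
have yx' i : related (S := row (A i) s) (row_nt (p i) s 0 y)
    (row_op (A i) u 0 (x' i)).
  apply/isocls_eq => //; rewrite -!isoclasses_mapE x'x; exact: yx.
pose f i : row (A i) s 1 := sval (cid (yx' i)).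
have fP i : source (f i) = row_nt (p i) s 0 y /\
            target (f i) = row_op (A i) u 0 (x' i).
  by rewrite /f; case: cid.
have [|g gf] := cone_clopen (hr s) (u := delta1) (y := y) (x := f).
  by move=> i; have [<- _] := fP i.
have [|z zx] := @cone_clopen _ _ _ _ _ hp (s, 0) (t, 0)
    (u, @idm simplex 0) (target g) x'.
  move=> i; have [_] := fP i; rewrite -gf target_nt.
  exact.
exists (isocls (S := row Y t) z) => i.
by rewrite [LHS]isoclasses_mapE -x'x /= zx.
Qed.

(** The composites are computed in the [A i]; the resulting family belongs to
    [Y] because its restriction to the first edge does. *)
Lemma segal_cone n (I : Type) (A : I -> msset n.+1) (Y : msset n.+1)
    (p : forall i, nattr Y (A i)) : (forall i, segal (A i)) ->
  clopen_cone p -> segal Y.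
Proof.
move=> hA hp s s2; have sA i := (is_isoP _).1 (hA i s s2).
have nuE i r (y : slice Y s r) j :
    p i _ (nu Y j r y) = nu (A i) j r (p i _ y) by rewrite /= ntP.
apply/is_isoP; split=> r => [y y' yy'|[e ge]].
  apply: (cone_inj hp) => i; apply: (sA i).1; apply: sig_inj.
  apply: funext => j; rewrite /= -!ntP; congr (p i _ _).
  exact: (congr1 (fun w => sval w j) yy').
have pe i :
    glued (d0 (A i)) (d1 (A i)) (fun j : 'I_s => slice_nt (p i) 1 r (e j)).
  move=> j l jl; rewrite /= -!ntP; congr (p i _ _).
  exact: ge.
pose x i := sval (cid ((sA i).2 r (exist _ _ (pe i)))).
have xe i j : nu (A i) j r (x i) = p i _ (e j).
  by rewrite /x; case: cid => z /= /(congr1 (fun w => sval w j)).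
pose j0 := Ordinal (leq_trans (isT : 0 < 2) s2).
have [|y yx] :=
  cone_clopen hp (u := dconsm (spine j0) (idm r)) (y := e j0) (x := x).
  by move=> i; rewrite -xe.
exists y; apply: sig_inj; apply: funext => j; apply: (cone_inj hp) => i.
by rewrite [LHS]nuE yx xe.
Qed.

(** The clauses defining Cat^n_hd are all inherited by [Y], the last one by
    induction through [clopen_cone_pn]. *)
Lemma hd_cone n (I : Type) (A : I -> msset n) (Y : msset n)
    (p : forall i, nattr Y (A i)) :
  (forall i, hd (A i)) -> clopen_cone p -> hd Y.
Proof.
elim: n A Y p => [//|[|n] IH] A Y p hA hp.
  apply/hd1P.
  apply: (relation_nerve_cone (clopen_cone_row (tt : dpow 0) hp)) => i.
  exact: hd_relation_nerve.
split=> [k||].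
- apply: IH (clopen_cone_slice k hp) => i; exact: hd_slice.
- by apply: segal_cone hp => i; case: (hA i).
- apply: IH (clopen_cone_pn hA hp) => i; exact: hd_pn.
Qed.

(** * The discretization *)

(** [disc Y] is [Y] with p applied in every direction, and each p preserves
    clopen cones, so that joint injectivity survives until the end. *)
Lemma disc_cone_inj n (I : Type) (A : I -> msset n) (Y : msset n)
    (p : forall i, nattr Y (A i)) (a b : disc Y (dzero n)) :
  (forall i, hd (A i)) -> clopen_cone p ->
  (forall i, disc_nt (p i) (dzero n) a = disc_nt (p i) (dzero n) b) -> a = b.
Proof.
elim: n A Y p a b => [|n IH] A Y p a b hA hp; first exact: (cone_inj hp).
apply: IH (clopen_cone_pn hA hp) => i; exact: hd_pn.
Qed.

(** A map of multi-indices acts on [disc X] through its image in the category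
    with one arrow, where every structure map is an identity. *)
Lemma disc_pmap_inj n (X : msset n) (s t : dpow n) (u : hom s t) :
  injective (pmap (disc X) u).
Proof.
elim: n X s t u => [|n IH] X s t u; last exact: IH.
case: s t u => -[] [] x y.
by move=> xy; rewrite -[x](@pmap1 onec X tt) -[y](@pmap1 onec X tt).
Qed.

Lemma disc_map_surj n (X : msset n) (hX : hd X) (a : disc X (dzero n)) :
  exists x, disc_map hX (dzero n) x = a.
Proof.
elim: n X hX a => [|n IH] X hX a; first by exists a.
have [c <-] := IH _ (hd_pn hX) a; elim/isoclasses_ind: c => x.
exists x; apply: (congr1 (disc_map (hd_pn hX) (dzero n))).
by congr isocls; apply: (@vert0 (row X (dzero n))).
Qed.

Lemma pn_nt_id n (X : msset n.+1) : pn_nt (ntid X) = ntid (pn X).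
Proof.
apply: nattr_eq => s c.
by elim/isoclasses_ind: c => x; rewrite [LHS]isoclasses_mapE.
Qed.

Lemma pn_nt_comp n (X Y Z : msset n.+1) (g : nattr Y Z) (f : nattr X Y) :
  pn_nt (ntcomp g f) = ntcomp (pn_nt g) (pn_nt f).
Proof.
apply: nattr_eq => s c.
by elim/isoclasses_ind: c => x; rewrite /= !isoclasses_mapE.
Qed.

Lemma disc_nt_id n (X : msset n) (s : dpow n) (a : disc X s) :
  disc_nt (ntid X) s a = a.
Proof.
elim: n X s a => [//|n IH] X s a.
exact: etrans (congr1 (fun f => disc_nt f s.1 a) (pn_nt_id X)) (IH _ s.1 a).
Qed.

Lemma disc_nt_comp n (X Y Z : msset n) (g : nattr Y Z) (f : nattr X Y)
    (s : dpow n) (a : disc X s) :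
  disc_nt (ntcomp g f) s a = disc_nt g s (disc_nt f s a).
Proof.
elim: n X Y Z g f s a => [//|n IH] X Y Z g f s a.
have e := congr1 (fun h => disc_nt h s.1 a) (pn_nt_comp g f).
exact: etrans e (IH _ _ _ _ _ s.1 a).
Qed.

Lemma disc_nt_iso n (X Y : msset n) (f : nattr X Y) (s : dpow n) : is_iso f ->
  injective (disc_nt f s) /\ forall b, exists a, disc_nt f s a = b.
Proof.
case=> g [fK gK].
have gf : ntcomp g f = ntid X by apply: nattr_eq => r x; apply: fK.
have fg : ntcomp f g = ntid Y by apply: nattr_eq => r x; apply: gK.
split=> [|b].
  apply: (can_inj (g := disc_nt g s)) => a.
  by rewrite -disc_nt_comp gf disc_nt_id.
by exists (disc_nt g s b); rewrite -disc_nt_comp fg disc_nt_id.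
Qed.

(** * The simplicial set of discretizations of the slices *)

Lemma slice_op_id n (X : msset n.+1) (k : simplex) :
  slice_op X (idm k) = ntid (slice X k).
Proof. by apply: nattr_eq => s x; rewrite /= dconsm1 pmap1. Qed.

Lemma slice_op_comp n (X : msset n.+1) (k l m : simplex)
    (psi : hom l m) (phi : hom k l) :
  slice_op X (cmp psi phi) = ntcomp (slice_op X phi) (slice_op X psi).
Proof. by apply: nattr_eq => s x; rewrite /= -pmapM -dconsmM cmp1m. Qed.

Lemma slice_nt_op n (X Y : msset n.+1) (f : nattr X Y) (k l : simplex)
    (phi : hom k l) :
  ntcomp (slice_nt f k) (slice_op X phi) =
  ntcomp (slice_op Y phi) (slice_nt f l).
Proof. by apply: nattr_eq => s x; rewrite /= ntP. Qed.

Definition disc_nerve n (X : msset n.+1) : psh simplex.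
Proof.
refine (@Psh simplex (fun k => disc (slice X k) (dzero n))
  (fun k l phi => disc_nt (slice_op X phi) (dzero n)) _ _).
- by move=> k a; rewrite slice_op_id disc_nt_id.
- by move=> k l m psi phi a; rewrite slice_op_comp disc_nt_comp.
Defined.

Definition disc_nerve_nt n (X Y : msset n.+1) (f : nattr X Y) :
  nattr (disc_nerve X) (disc_nerve Y).
Proof.
refine (@NatTr simplex (disc_nerve X) (disc_nerve Y)
  (fun k => disc_nt (slice_nt f k) (dzero n)) _).
by move=> k l phi a; rewrite /= -!disc_nt_comp slice_nt_op.
Defined.

Section DiscNervePn.
Variables (n : nat).

#[local] Obligation Tactic := idtac.

(** The two rows are equal by [row_slice], but the equality does not hold by
    computation; using maps that are the identity on simplices avoids
    transporting along it. *)
Program Definition row_slice_nt (X : msset n.+2) k s :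
    nattr (row (slice X k) s) (row X (dcons k s)) := {| ntf := fun l x => x |}.
Next Obligation.
move=> X k s l m phi x; have e := dconsm1 (k : simplex) s.
exact: (@pmap_pair n.+1 X _ _ l m _ _ phi _ x e erefl).
Qed.

Program Definition row_slice_inv (X : msset n.+2) k s :
    nattr (row X (dcons k s)) (row (slice X k) s) := {| ntf := fun l x => x |}.
Next Obligation.
move=> X k s l m phi x; have e := esym (dconsm1 (k : simplex) s).
exact: (@pmap_pair n.+1 X _ _ l m _ _ phi _ x e erefl).
Qed.

Program Definition pn_slice_nt (X : msset n.+2) k :
    nattr (pn (slice X k)) (slice (pn X) k) :=
  {| ntf := fun s => isoclasses_map (row_slice_nt X k s) |}.
Next Obligation.
by move=> X k s t u; elim/isoclasses_ind => x; rewrite /= !isoclasses_mapE.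
Qed.

Program Definition pn_slice_inv (X : msset n.+2) k :
    nattr (slice (pn X) k) (pn (slice X k)) :=
  {| ntf := fun s => isoclasses_map (row_slice_inv X k s) |}.
Next Obligation.
by move=> X k s t u; elim/isoclasses_ind => x; rewrite /= !isoclasses_mapE.
Qed.

Lemma pn_slice_iso (X : msset n.+2) k : is_iso (pn_slice_nt X k).
Proof.
by exists (pn_slice_inv X k); split=> s; elim/isoclasses_ind => x;
  rewrite /= !isoclasses_mapE.
Qed.

(** p in the last direction commutes with taking slices in the first one, and
    does not change the discretization; so [X] and [p(X)] have the same
    [disc_nerve]. *)
Definition disc_nerve_pn (X : msset n.+2) :
  nattr (disc_nerve X) (disc_nerve (pn X)).
Proof.
refine (@NatTr simplex (disc_nerve X) (disc_nerve (pn X))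
  (fun k => disc_nt (pn_slice_nt X k) (dzero n)) _).
move=> k l phi a.
rewrite -[pmap (disc_nerve X) phi a]
  /(disc_nt (pn_nt (slice_op X phi)) (dzero n) a).
rewrite -[RHS]disc_nt_comp -[LHS]disc_nt_comp.
apply: (congr1 (fun h => disc_nt h (dzero n) a)); apply: nattr_eq => s c.
by elim/isoclasses_ind: c => x; rewrite /= !isoclasses_mapE.
Defined.

Lemma disc_nerve_pn_bij (X : msset n.+2) k :
  injective (disc_nerve_pn X k) /\ forall b, exists a, disc_nerve_pn X k a = b.
Proof. exact/disc_nt_iso/pn_slice_iso. Qed.

Lemma disc_nerve_pn_natural (X Y : msset n.+2) (f : nattr X Y) k
    (a : disc_nerve X k) :
  disc_nerve_pn Y k (disc_nerve_nt f k a) =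
  disc_nerve_nt (pn_nt f) k (disc_nerve_pn X k a).
Proof.
rewrite -[disc_nerve_nt f k a]/(disc_nt (pn_nt (slice_nt f k)) (dzero n) a).
rewrite -[RHS]disc_nt_comp -[LHS]disc_nt_comp.
apply: (congr1 (fun h => disc_nt h (dzero n) a)); apply: nattr_eq => s c.
by elim/isoclasses_ind: c => x; rewrite /= !isoclasses_mapE.
Qed.

End DiscNervePn.

(** In dimension 1 the discretization of a slice is the slice itself, a set, and
    [disc_nerve X] is the nerve of [X]. *)
Lemma relation_nerve_disc_nerve n (X : msset n.+1) :
  hd X -> relation_nerve (disc_nerve X).
Proof.
elim: n X => [|n IH] X hX.
  pose p (i : unit) : nattr (disc_nerve X) (row X tt) :=
    @NatTr simplex (disc_nerve X) (row X tt) (fun k x => x)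
      (fun _ _ _ _ => erefl).
  apply: (@relation_nerve_cone _ _ _ p) => [|_]; last exact/hd1P.
  split=> [k x y /(_ tt)//|k l u y x _]; by exists (x tt); case.
pose p (i : unit) := disc_nerve_pn X.
apply: (@relation_nerve_cone _ _ _ p) => [|_]; last exact/IH/hd_pn.
have bij := disc_nerve_pn_bij X.
split=> [k x y /(_ tt)/(bij k).1//|k l u y x _].
by have [y' yx] := (bij l).2 (x tt); exists y' => -[].
Qed.

(** Indeed [X^d] is the set of classes of [related] on [disc_nerve X], naturally
    in [X]: in dimension 1 by definition of [X^d], and in higher dimensions
    because [X] and [p(X)] have the same [disc_nerve] and the same
    discretization. *)
Lemma disc_nerve_reflects_related n (X Y : msset n.+1) (f : nattr X Y) :
  hd X -> hd Y ->
  injective (disc_nt f (dzero n.+1)) ->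
  forall a b : disc_nerve X 0,
    related (disc_nerve_nt f 0 a) (disc_nerve_nt f 0 b) -> related a b.
Proof.
elim: n X Y f => [|n IH] X Y f hX hY f_inj a b ab.
  have rX := (hd1P X).1 hX; have rY := (hd1P Y).1 hY.
  suff: related (S := row X tt) a b by [].
  apply/isocls_eq => //; apply: f_inj.
  by rewrite ![disc_nt _ _ _]isoclasses_mapE; apply/isocls_eq.
have [inj0 _] := disc_nerve_pn_bij X 0; have [_ surj1] := disc_nerve_pn_bij X 1.
have /(related_nt (disc_nerve_pn Y)) := ab; rewrite !disc_nerve_pn_natural.
move=> /(IH _ _ _ (hd_pn hX) (hd_pn hY) f_inj)[e [es et]].
have [e' ee] := surj1 e; exists e'.
by split; apply: inj0; rewrite -1?source_nt -1?target_nt ee.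
Qed.

(** * Fibres and glued products *)

Lemma fiber_incl_subproof n (X : msset n.+2) (hX : hd X) (a b : points X)
  s t (u : hom s t) (x : fiber hX a b t) :
  sval (pmap (fiber hX a b) u x) = pmap (slice X 1) u (sval x).
Proof. by []. Qed.

Definition fiber_incl n (X : msset n.+2) (hX : hd X) (a b : points X) :
  nattr (fiber hX a b) (slice X 1) := NatTr (@fiber_incl_subproof n X hX a b).

Lemma at_level_pmap n (X : msset n.+2) (a : points X) s t (u : hom s t) :
  at_level a s = pmap (disc (slice X 0)) u (at_level a t).
Proof. by rewrite /at_level -pmapM; congr (pmap _ _ a); apply: dto0_uniq. Qed.

Lemma at_level_zero n (X : msset n.+2) (a : points X) :
  at_level a (dzero n.+1) = a.
Proof.
by rewrite -[RHS]pmap1 /at_level; congr (pmap _ _ a); apply: dto0_uniq.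
Qed.

(** The condition that cuts out the fibre compares elements of the discrete
    object [X_0^d], where restriction is injective; so it may be tested after
    restriction.  The same reason gives [disc_glue_cone]. *)
Lemma fiber_cone n (X : msset n.+2) (hX : hd X) (a b : points X) :
  clopen_cone (fun _ : unit => fiber_incl hX a b).
Proof.
split=> [s y y' /(_ tt)|s t u y x /(_ tt) /= yx]; first exact: sig_inj.
have [ya yb] := svalP y.
suff xab : in_fiber hX a b (x tt) by exists (exist _ _ xab) => -[].
split; apply: (@disc_pmap_inj _ _ _ _ u).
  by rewrite -at_level_pmap -ya yx !ntP.
by rewrite -at_level_pmap -yb yx !ntP.
Qed.

Lemma disc_glue_cone n (X : msset n.+2) (hX : hd X) s :
  clopen_cone (fun i : 'I_s =>
    glue_pr (ntcomp (gamma0 hX) (d0 X)) (ntcomp (gamma0 hX) (d1 X)) i).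
Proof.
split=> [r y y' yy'|r t u y x yx]; first by apply/sig_inj/funext/yy'.
suff gx : glued (ntcomp (gamma0 hX) (d0 X)) (ntcomp (gamma0 hX) (d1 X)) x.
  by exists (exist _ _ gx).
move=> i j ij; apply: (@disc_pmap_inj _ _ _ _ u); rewrite -!ntP -!yx.
exact: (svalP y).
Qed.

Section FiberPoints.
Variables (n : nat) (X : msset n.+2) (hX : hd X) (a b : points X).

Lemma hd_fiber : hd (fiber hX a b).
Proof. exact: hd_cone (fun=> hd_slice 1 hX) (fiber_cone hX a b). Qed.

Lemma disc_nerve_disc_map (phi : @hom simplex 0 1)
    (x : slice X 1 (dzero n.+1)) :
  pmap (disc_nerve X) phi (disc_map (hd_slice 1 hX) (dzero n.+1) x) =
  gamma0 hX (dzero n.+1) (slice_op X phi (dzero n.+1) x).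
Proof. exact/esym/disc_map_natural. Qed.

(** The direction of the edge is that of the definition of [X(a, b)], where
    [d0], the target, lies over [a]. *)
Lemma fiber_edge (x : fiber hX a b (dzero n.+1)) :
  let e : disc_nerve X 1 := disc_map (hd_slice 1 hX) (dzero n.+1) (sval x) in
  source e = b /\ target e = a.
Proof.
by case: (svalP x) => xa xb; rewrite /source /target !disc_nerve_disc_map
  [LHS in _ /\ LHS = _]xa [LHS in LHS = _ /\ _]xb !at_level_zero.
Qed.

End FiberPoints.

(** [X(a, b)^d] embeds into the set of edges of [disc_nerve X], and the edges
    coming from [X(a, b)] have the same ends. *)
Lemma disc_fiber_eq n (X : msset n.+2) (hX : hd X) (a b : points X)
  (alpha beta : disc (fiber hX a b) (dzero n.+1)) : alpha = beta.
Proof.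
have [x <-] := disc_map_surj (hd_fiber hX a b) alpha.
have [y <-] := disc_map_surj (hd_fiber hX a b) beta.
apply: (disc_cone_inj (fun=> hd_slice 1 hX) (fiber_cone hX a b)) => _.
rewrite -!(disc_map_natural _ (hd_slice 1 hX)) /=.
have [xs xt] := fiber_edge x; have [ys yt] := fiber_edge y.
by apply: (edge_eq (relation_nerve_disc_nerve hX)); rewrite ?xs ?xt ?ys ?yt.
Qed.

(** Every edge of [disc_nerve X] from [b] to [a] is the class of a point of
    [X_1], and such a point lies in the fibre. *)
Lemma fiber_inhabited n (X : msset n.+2) (hX : hd X) (a b : points X) :
  related (S := disc_nerve X) b a <->
  exists x : fiber hX a b (dzero n.+1), True.
Proof.
split=> [[e [es et]]|[x _]]; last by eexists; apply: fiber_edge x.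
have [x xe] := disc_map_surj (hd_slice 1 hX) e.
suff xab : in_fiber hX a b x by exists (exist _ x xab).
by split; rewrite at_level_zero -?es -?et -xe; apply/esym/disc_nerve_disc_map.
Qed.

(** * Equivalences and discretizations *)

(** The sets [X(a, b)^d] and [Y(f a, f b)^d] have at most one element, so on
    fibres the only question is whether [X(a, b)] is inhabited when
    [Y(f a, f b)] is; injectivity on [X^d] answers it, by
    [disc_nerve_reflects_related]. *)
Lemma n_equivalence_of_disc_bij n (X Y : msset n.+1) (f : nattr X Y) :
  hd X -> hd Y -> injective (disc_nt f (dzero n.+1)) ->
  (forall b, exists a, disc_nt f (dzero n.+1) a = b) -> n_equivalence f.
Proof.
elim: n X Y f => [|n IH] X Y f hX hY f_inj f_surj.
  split=> //; have rX := (hd1P X).1 hX; have rY := (hd1P Y).1 hY.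
  apply: equivalence_of_bij => // [x y|y].
    move=> /(isocls_eq rY) fxy; apply/(isocls_eq rX)/f_inj.
    by rewrite ![disc_nt _ _ _]isoclasses_mapE.
  have [c] := f_surj (isocls (S := row Y tt) y).
  elim/isoclasses_ind: c => x; rewrite [disc_nt _ _ _]isoclasses_mapE.
  by move=> /(isocls_eq rY); exists x.
exists hX, hY; split=> [a b|].
  apply: IH (hd_fiber _ _ _) (hd_fiber _ _ _) _ _ => [x y _|y].
    exact: disc_fiber_eq.
  suff [x _] : exists x : fiber hX a b (dzero n.+1), True.
    by exists (disc_map (hd_fiber hX a b) _ x); apply: disc_fiber_eq.
  have [z _] := disc_map_surj (hd_fiber hY _ _) y.
  apply/fiber_inhabited/(disc_nerve_reflects_related hX hY f_inj).
  by apply/fiber_inhabited; exists z.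
exact: IH (hd_pn hX) (hd_pn hY) f_inj f_surj.
Qed.

Theorem proposition3p11 (n : nat) (X : psh (dpow n.+2)) (hX : hd X)
    (s : nat) (hs : 2 <= s) :
  @n_equivalence n.+1 _ _ (induced_segal_map hX s).
Proof.
have hXs := hd_slice s hX.
have hG := hd_cone (fun=> hd_slice 1 hX) (disc_glue_cone hX s).
have rX := relation_nerve_disc_nerve hX.
(* On discretizations the induced Segal map is the Segal map of
   [disc_nerve X]. *)
have prE (i : 'I_s) (a : disc_nerve X s) :
    disc_nt (glue_pr (ntcomp (gamma0 hX) (d0 X)) (ntcomp (gamma0 hX) (d1 X)) i)
      (dzero n.+1) (disc_nt (induced_segal_map hX s) (dzero n.+1) a) =
    pmap (disc_nerve X) (spine i) a.
  rewrite -disc_nt_comp; apply: (congr1 (fun h => disc_nt h (dzero n.+1) a)).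
  by apply: nattr_eq => r x; apply: induced_segal_mapP.
apply: n_equivalence_of_disc_bij => // [a b ab|c].
  apply: (relation_nerve_spine_inj rX) => // i.
  by rewrite -!prE ab.
have [y <-] := disc_map_surj hG c.
have [|a ae] := relation_nerve_fillable rX
    (e := fun i => disc_map (hd_slice 1 hX) (dzero n.+1) (sval y i)) hs.
  move=> i j ij; rewrite /source /target !disc_nerve_disc_map.
  exact: (svalP y).
exists a.
apply: (disc_cone_inj (fun=> hd_slice 1 hX) (disc_glue_cone hX s)) => i.
by rewrite prE ae -(disc_map_natural hG (hd_slice 1 hX)).
Qed.
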